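(* Let $q$ be a prime power and let $n_1\ge k_1\ge 1$, $n_2\ge k_2\ge 1$ and $t$ be integers with $0\le t\le\min\{k_1,k_2\}$ and $t<k_1+k_2-t$. Suppose that $n_1-k_1=n_2-k_2=r$ and $n_1+n_2\le q-1$. Then there exists an optimal $[n_1,k_1;n_2,k_2;t]$-LEDC over $\mathbb{F}_q$ whose minimum distance is $r+t+1$.
   Context: Put $k=k_1+k_2-t$, $n=n_1+n_2$, $K_1=\{1,\dots,k_1\}$, $K_2=\{k_1-t+1,\dots,k\}$, $N_1=\{1,\dots,n_1\}$, $N_2=\{n_1+1,\dots,n\}$, so that $|K_1\cap K_2|=t$. An $[n_1,k_1;n_2,k_2;t]$-LEDC over $\mathbb{F}_q$ is a linear map $x\mapsto c=xG$, $\mathbb{F}_q^k\to\mathbb{F}_q^n$, given by a $k\times n$ matrix $G$ over $\mathbb{F}_q$, such that for $i=1,2$: (P1) the coded symbols $\{c_j : j\in N_i\}$ depend only on the data symbols $\{x_j : j\in K_i\}$; (P2) the data symbols $\{x_j : j\in K_i\}$ are determined by any $k_i$ of the coded symbols $\{c_j : j\in N_i\}$. Its minimum distance is the minimum Hamming distance of the linear code $\{xG : x\in\mathbb{F}_q^k\}$. It is called optimal if its minimum distance is the largest possible among all $[n_1,k_1;n_2,k_2;t]$-LEDCs with the same parameters (over any finite field). *)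

(* Defs.v *)
From mathcomp Require Import all_boot all_order all_algebra.

Set Implicit Arguments.
Unset Strict Implicit.
Unset Printing Implicit Defensive.

Import GRing.Theory.
Local Open Scope ring_scope.

Definition hamming_dist (F : finFieldType) (n : nat) (u v : 'rV[F]_n) : nat :=
  #|[set j | u 0 j != v 0 j]|.

Definition code (F : finFieldType) (k n : nat) (G : 'M[F]_(k, n)) :
    {set 'rV[F]_n} :=
  [set x *m G | x : 'rV[F]_k].

(* Distances are at most n, so the default value n of the iterated minimum is
   harmless whenever C has at least two words; a code with fewer than two words
   gets the conventional value n. *)
Definition min_distance (F : finFieldType) (n : nat) (C : {set 'rV[F]_n}) :
    nat :=
  \big[minn/n]_(p in setX C C | p.1 != p.2) hamming_dist p.1 p.2.

(* Indices start at 0 here: K1 = {0..k1-1}, K2 = {k1-t..k1+k2-t-1},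
   N1 = {0..n1-1}, N2 = {n1..n1+n2-1}. *)
Definition data1 (k1 k2 t : nat) : {set 'I_(k1 + k2 - t)} :=
  [set j : 'I_(k1 + k2 - t) | (j < k1)%N].

Definition data2 (k1 k2 t : nat) : {set 'I_(k1 + k2 - t)} :=
  [set j : 'I_(k1 + k2 - t) | (k1 - t <= j)%N].

Definition coded1 (n1 n2 : nat) : {set 'I_(n1 + n2)} :=
  [set j : 'I_(n1 + n2) | (j < n1)%N].

Definition coded2 (n1 n2 : nat) : {set 'I_(n1 + n2)} :=
  [set j : 'I_(n1 + n2) | (n1 <= j)%N].

Definition coded_depends_on (F : finFieldType) (k n : nat) (G : 'M[F]_(k, n))
    (K : {set 'I_k}) (N : {set 'I_n}) : Prop :=
  forall x y : 'rV[F]_k, {in K, forall j, x 0 j = y 0 j} ->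
    {in N, forall j, (x *m G) 0 j = (y *m G) 0 j}.

Definition data_determined_by (F : finFieldType) (k n : nat) (G : 'M[F]_(k, n))
    (K : {set 'I_k}) (S : {set 'I_n}) : Prop :=
  forall x y : 'rV[F]_k, {in S, forall j, (x *m G) 0 j = (y *m G) 0 j} ->
    {in K, forall j, x 0 j = y 0 j}.

Record is_LEDC (n1 k1 n2 k2 t : nat) (F : finFieldType)
    (G : 'M[F]_(k1 + k2 - t, n1 + n2)) : Prop := IsLEDC {
  LEDC_depends1 : coded_depends_on G (data1 k1 k2 t) (coded1 n1 n2);
  LEDC_depends2 : coded_depends_on G (data2 k1 k2 t) (coded2 n1 n2);
  LEDC_determined1 : forall S : {set 'I_(n1 + n2)},
    S \subset coded1 n1 n2 -> #|S| = k1 ->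
    data_determined_by G (data1 k1 k2 t) S;
  LEDC_determined2 : forall S : {set 'I_(n1 + n2)},
    S \subset coded2 n1 n2 -> #|S| = k2 ->
    data_determined_by G (data2 k1 k2 t) S
}.

Arguments is_LEDC n1 k1 n2 k2 t {F} G.

Definition optimal_LEDC (n1 k1 n2 k2 t : nat) (F : finFieldType)
    (G : 'M[F]_(k1 + k2 - t, n1 + n2)) : Prop :=
  is_LEDC n1 k1 n2 k2 t G /\
  forall (F' : finFieldType) (G' : 'M[F']_(k1 + k2 - t, n1 + n2)),
    is_LEDC n1 k1 n2 k2 t G' ->
    (min_distance (code G') <= min_distance (code G))%N.

Arguments optimal_LEDC n1 k1 n2 k2 t {F} G.

(* Main.v *)
(** Fix distinct points a_j in F.  A word of length n_i is determined by its
    moments \sum_j c_j a_j^e for e < n_i.  Let the moments on N_1 and on N_2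
    vanish for e < r, be the shared data and its opposite respectively for
    r <= e < r + t, and be the private data for larger e.  A word on N_i with r
    vanishing moments and weight at most r is 0, which gives (P2); the first
    r + t moments of the whole word cancel, so a nonzero word has weight at
    least r + t + 1.  Conversely, if t < k_2, annihilating K_1 and k_2 - t - 1
    coordinates of N_2 leaves a nonzero word of weight at most r + t + 1, and
    symmetrically if t < k_1. *)
Require Import Defs.
From mathcomp Require Import all_boot all_order all_algebra.
From mathcomp Require Import zify.

Set Implicit Arguments.
Unset Strict Implicit.
Unset Printing Implicit Defensive.

Import GRing.Theory.
Local Open Scope ring_scope.

(** * Sparse words with vanishing moments *)

(** Vanishing of the first [m] moments makes [c] orthogonal to the values of every polynomial of
    degree below [m]. A polynomial of degree [#|A| - 1] that vanishes on [A] except at one point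
    then isolates a single entry. In other terms, any [m] rows of a Vandermonde matrix with [m]
    columns are independent. *)
Lemma sparse_moments_eq0 (F : fieldType) (I : finType) (a c : I -> F)
    (A : {set I}) (m : nat) :
  injective a -> (#|A| <= m)%N -> (forall j, j \notin A -> c j = 0) ->
  (forall i, (i < m)%N -> \sum_j c j * a j ^+ i = 0) ->
  forall j, c j = 0.
Proof.
move=> inj_a leAm cA0 mom0 j0.
have [Aj0 | /cA0 //] := boolP (j0 \in A).
(* The combination of moments given by p sees only the point a j0. *)
pose p : {poly F} := \prod_(j in A :\ j0) ('X - (a j)%:P).
have sz_p : (size p <= m)%N.
  rewrite /p -big_enum size_prod_XsubC -cardE (leq_trans _ leAm) //.
  by rewrite (cardsD1 j0 A) Aj0.
have sum0 : \sum_j c j * p.[a j] = 0.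
  under eq_bigr do rewrite horner_coef big_distrr /=.
  rewrite exchange_big big1 //= => i _.
  under eq_bigr do rewrite mulrCA.
  by rewrite -big_distrr /= mom0 ?mulr0 // (leq_trans (ltn_ord i)).
have pj0 : p.[a j0] != 0.
  rewrite horner_prod; apply/prodf_neq0 => j.
  by rewrite !inE hornerXsubC subr_eq0 (inj_eq inj_a) eq_sym => /andP[].
have pj j : j != j0 -> c j * p.[a j] = 0.
  move=> nj; have [Aj | /cA0 ->] := boolP (j \in A); last by rewrite mul0r.
  by rewrite horner_prod (bigD1 j) ?inE ?nj //= hornerXsubC subrr mul0r mulr0.
move: sum0; rewrite (bigD1 j0) //= big1 // addr0 => /eqP.
by rewrite mulf_eq0 (negPf pj0) orbF => /eqP.
Qed.

(** A row in the left kernel of this Vandermonde matrix is a word with [m] vanishing moments on [m]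
    points, so the previous lemma applies with the whole index set as [A]. *)
Lemma moments_unit (F : fieldType) (m : nat) (a : 'I_m -> F) :
  injective a -> (\matrix_(j < m, i < m) a j ^+ i) \in unitmx.
Proof.
move=> inj_a; rewrite -row_free_unit; apply/inj_row_free => v v0.
apply/rowP => j; rewrite mxE.
apply: (@sparse_moments_eq0 _ _ a (v 0) setT m) => //.
- by rewrite cardsT card_ord.
- by move=> i; rewrite inE.
move=> i lt_i; have := congr1 (fun w : 'rV_m => w 0 (Ordinal lt_i)) v0.
rewrite !mxE => vi0; rewrite -[RHS]vi0.
by apply: eq_bigr => j' _; rewrite mxE.
Qed.

(** * Cardinalities of the index sets *)

Lemma exists_subset_card (T : finType) (A : {set T}) (s : nat) :
  (s <= #|A|)%N -> exists2 B : {set T}, B \subset A & #|B| = s.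
Proof.
move=> les; exists [set x in take s (enum A)].
  by apply/subsetP=> x; rewrite inE => /mem_take; rewrite mem_enum.
rewrite cardsE; have /card_uniqP -> := take_uniq s (enum_uniq A).
by rewrite size_takel // -cardE.
Qed.

Lemma card_ord_lt (n m : nat) : (m <= n)%N -> #|[set j : 'I_n | (j < m)%N]| = m.
Proof.
move=> le_mn.
have inj_w : injective (widen_ord le_mn) by move=> i j [] /val_inj.
rewrite -[RHS]card_ord -(card_imset _ inj_w).
apply: eq_card => j; rewrite inE; apply/idP/imsetP => [lt_j | [i _ ->]] /=.
  by exists (Ordinal lt_j) => //; apply: val_inj.
exact: ltn_ord.
Qed.

Lemma card_ord_ge (n m : nat) :
  (m <= n)%N -> #|[set j : 'I_n | (m <= j)%N]| = (n - m)%N.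
Proof.
move=> le_mn; have := cardsC [set j : 'I_n | (j < m)%N].
rewrite card_ord card_ord_lt // => /(canRL (addKn m)) <-.
by apply: eq_card => j; rewrite !inE leqNgt.
Qed.

Lemma card_coded1 (n1 n2 : nat) : #|coded1 n1 n2| = n1.
Proof. by rewrite card_ord_lt ?leq_addr. Qed.

Lemma card_coded2 (n1 n2 : nat) : #|coded2 n1 n2| = n2.
Proof. by rewrite card_ord_ge ?leq_addr // addKn. Qed.

Lemma card_data1 (k1 k2 t : nat) : (t <= k2)%N -> #|data1 k1 k2 t| = k1.
Proof. by move=> let2; rewrite card_ord_lt // -addnBA // leq_addr. Qed.

Lemma card_data2 (k1 k2 t : nat) : (t <= k1)%N -> #|data2 k1 k2 t| = k2.
Proof. by move=> let1; rewrite card_ord_ge; lia. Qed.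

(** * Hamming weight and bounds on the minimum distance of a linear code *)

Definition hamming_weight (F : finFieldType) (n : nat) (u : 'rV[F]_n) : nat :=
  #|[set j | u 0 j != 0]|.

Lemma hamming_distE (F : finFieldType) (n : nat) (u v : 'rV[F]_n) :
  hamming_dist u v = hamming_weight (u - v).
Proof. by apply: eq_card => j; rewrite !inE !mxE subr_eq0. Qed.

Section Distance.

Variables (F : finFieldType) (k n : nat) (G : 'M[F]_(k, n)).

Lemma min_distance_ge (d : nat) : (d <= n)%N ->
  (forall x : 'rV[F]_k, x *m G != 0 -> (d <= hamming_weight (x *m G))%N) ->
  (d <= min_distance (code G))%N.
Proof.
(* Here [led] settles the default value [n] of the iterated minimum. *)
move=> led wt; rewrite /min_distance; elim/big_ind: _ => // [d1 d2 h1 h2 | [u v] /=].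
  by rewrite leq_min h1.
rewrite inE => /andP[/andP[/imsetP[x _ /= ->] /imsetP[y _ /= ->]]].
rewrite -subr_eq0 hamming_distE -mulmxBl; exact: wt.
Qed.

Lemma min_distance_le (x : 'rV[F]_k) : x *m G != 0 ->
  (min_distance (code G) <= hamming_weight (x *m G))%N.
Proof.
move=> nz; rewrite -[x *m G]subr0 -hamming_distE.
apply: (@Order.TotalTheory.bigmin_le_cond _ nat _ _ (x *m G, 0)).
rewrite /= nz andbT inE /=.
by apply/andP; split; apply/imsetP; [exists x | exists 0; rewrite ?mul0mx].
Qed.

(** Dimension count: the columns of [B] are the linear forms to be annihilated, and there are fewer
    of them than the [k] unknowns. *)
Lemma exists_vanishing_word (K : {set 'I_k}) (J : {set 'I_n}) :
  (#|K| + #|J| < k)%N ->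
  exists2 x : 'rV[F]_k, x != 0 &
    {in K, forall i, x 0 i = 0} /\ {in J, forall j, (x *m G) 0 j = 0}.
Proof.
move=> ltk; pose f (i : 'I_#|K|) := enum_val i; pose g (j : 'I_#|J|) := enum_val j.
pose B := row_mx (colsub f 1%:M) (colsub g G).
have /rowV0Pn[x /sub_kermxP xB nz_x] : kermx B != 0.
  rewrite kermx_eq0 /row_free neq_ltn (leq_ltn_trans (rank_leq_col _)) //.
exists x => //; move: xB; rewrite mul_mx_row -row_mx0 => /eq_row_mx[xK xJ]; split.
  move=> i Ki; have := congr1 (fun w : 'rV_#|K| => w 0 (enum_rank_in Ki i)) xK.
  by rewrite mulmx_colsub mulmx1 !mxE /f enum_rankK_in.
move=> j Jj; have := congr1 (fun w : 'rV_#|J| => w 0 (enum_rank_in Jj j)) xJ.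
by rewrite mulmx_colsub [X in X = _]mxE [RHS]mxE /g enum_rankK_in.
Qed.

(** Data vanishing on [K] give a word vanishing on [N]. Asking that it also vanish on [J] leaves at
    most [n - (#|N| + #|J|)] nonzero positions. *)
Lemma min_distance_vanishing (K : {set 'I_k}) (N J : {set 'I_n}) :
  (forall x : 'rV[F]_k, x *m G = 0 -> x = 0) ->
  coded_depends_on G K N -> [disjoint N & J] -> (#|K| + #|J| < k)%N ->
  (min_distance (code G) <= n - (#|N| + #|J|))%N.
Proof.
move=> injG depG disNJ /exists_vanishing_word[x nz_x [xK xJ]].
have nz_xG : x *m G != 0 by apply: contra_neq nz_x => /injG.
apply: leq_trans (min_distance_le nz_xG) _.
have -> : (#|N| + #|J|)%N = #|N :|: J|.
  by rewrite cardsU disjoint_setI0 // cards0 subn0.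
rewrite -[n in (n - _)%N]card_ord -(cardsC (N :|: J)) addKn.
apply/subset_leq_card/subsetP => j; rewrite !inE; apply: contraNN.
case/orP => [Nj | /xJ -> //]; rewrite (depG x 0 _ j Nj) ?mul0mx ?mxE //.
by move=> i /xK ->; rewrite mxE.
Qed.

End Distance.

(** * Upper bound for the minimum distance of every LEDC *)

(** Each block has at least [k1], respectively [k2], coded symbols, so (P2) recovers the data on
    both index sets, which together cover all indices. *)
Lemma LEDC_inj (n1 k1 n2 k2 t : nat) (F : finFieldType)
    (G : 'M[F]_(k1 + k2 - t, n1 + n2)) (x : 'rV[F]_(k1 + k2 - t)) :
  (k1 <= n1)%N -> (k2 <= n2)%N -> is_LEDC n1 k1 n2 k2 t G ->
  x *m G = 0 -> x = 0.
Proof.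
move=> le1 le2 [_ _ det1 det2] xG; apply/rowP => i.
have [S1 subS1 cS1] : exists2 S : {set _}, S \subset coded1 n1 n2 & #|S| = k1.
  by apply: exists_subset_card; rewrite card_coded1.
have [S2 subS2 cS2] : exists2 S : {set _}, S \subset coded2 n1 n2 & #|S| = k2.
  by apply: exists_subset_card; rewrite card_coded2.
have [lti | lei] := ltnP i k1.
  by apply: (det1 S1) => //; [move=> j _; rewrite xG mul0mx | rewrite inE].
apply: (det2 S2) => //; first by move=> j _; rewrite xG mul0mx.
by rewrite inE (leq_trans (leq_subr _ _) lei).
Qed.

Lemma LEDC_min_distance_le (n1 k1 n2 k2 t r : nat) (F : finFieldType)
    (G : 'M[F]_(k1 + k2 - t, n1 + n2)) :
  n1 = (k1 + r)%N -> n2 = (k2 + r)%N -> (t <= k1)%N -> (t <= k2)%N ->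
  (t < k1 + k2 - t)%N -> is_LEDC n1 k1 n2 k2 t G ->
  (min_distance (code G) <= r + t + 1)%N.
Proof.
move=> n1E n2E let1 let2 ltt ledc.
have injG (x : 'rV[F]_(k1 + k2 - t)) : x *m G = 0 -> x = 0.
  by apply: (LEDC_inj _ _ ledc); lia.
have dis : [disjoint coded1 n1 n2 & coded2 n1 n2].
  by rewrite -setI_eq0; apply/eqP/setP=> j; rewrite !inE; lia.
(* The conditions on the data number [k1 + (k2 - t - 1)], one less than the dimension, and
   [n2 - (k2 - t - 1) = r + t + 1] positions remain. If [t = k2], then [ltt] gives [t < k1] and the
   blocks exchange roles. *)
have [lt2 | ge2] := ltnP t k2.
  have [J subJ cJ] : exists2 J : {set _},
      J \subset coded2 n1 n2 & #|J| = (k2 - t - 1)%N.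
    by apply: exists_subset_card; rewrite card_coded2; lia.
  have := min_distance_vanishing injG (LEDC_depends1 ledc)
    (disjointWr subJ dis).
  by rewrite card_data1 // card_coded1 cJ; lia.
have [J subJ cJ] : exists2 J : {set _},
    J \subset coded1 n1 n2 & #|J| = (k1 - t - 1)%N.
  by apply: exists_subset_card; rewrite card_coded1; lia.
have := min_distance_vanishing (J := J) injG (LEDC_depends2 ledc).
rewrite disjoint_sym (disjointWl subJ dis) card_data2 // card_coded2 cJ.
by move/(_ isT); lia.
Qed.

(** * Codes with prescribed moments *)

(* When used as a matrix of moments, it assigns to the data x the word whose e-th
   moment is s e * x_(f e). *)
Definition placement_mx (F : fieldType) (k m : nat) (s : nat -> F)
    (f : nat -> nat) : 'M[F]_(k, m) :=
  \matrix_(i < k, j < m) (s j *+ (i == f j :> nat)).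

Lemma mul_placement_mx (F : fieldType) (k m : nat) (s : nat -> F)
    (f : nat -> nat) (x : 'rV[F]_k) (i : 'I_k) (j : 'I_m) :
  f j = i -> (x *m placement_mx k m s f) 0 j = s j * x 0 i.
Proof.
move=> fj; rewrite mxE (bigD1 i) //= big1 ?addr0 => [|i' ne_i].
  by rewrite mxE fj eqxx mulr1n mulrC.
by rewrite mxE fj (inj_eq val_inj) (negPf ne_i) mulr0.
Qed.

Lemma mul_placement_mx0 (F : fieldType) (k m : nat) (s : nat -> F)
    (f : nat -> nat) (x : 'rV[F]_k) (j : 'I_m) :
  s j = 0 -> (x *m placement_mx k m s f) 0 j = 0.
Proof. by move=> sj; rewrite mxE big1 // => i _; rewrite mxE sj mul0rn mulr0. Qed.

(** If two data vectors agree on the coded positions [S], the difference of their words, restricted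
    to [N], lives on at most [r] positions and has [r] vanishing moments, so it is zero. Then all
    its moments vanish, and [K] can be read off the moments. *)
Lemma moments_determine (F : finFieldType) (k n m r : nat) (a : 'I_n -> F)
    (G : 'M[F]_(k, n)) (E : 'M[F]_(k, m)) (K : {set 'I_k}) (N S : {set 'I_n}) :
  injective a ->
  (forall (x : 'rV[F]_k) (i : 'I_m),
     \sum_(j in N) (x *m G) 0 j * a j ^+ i = (x *m E) 0 i) ->
  (r <= m)%N ->
  (forall (x : 'rV[F]_k) (i : 'I_m), (i < r)%N -> (x *m E) 0 i = 0) ->
  (forall x : 'rV[F]_k, x *m E = 0 -> {in K, forall i, x 0 i = 0}) ->
  S \subset N -> (#|N| <= #|S| + r)%N -> data_determined_by G K S.
Proof.
move=> inj_a momE lerm E0 EK subS cardN x y eqS i Ki.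
apply/eqP; rewrite -subr_eq0; apply/eqP.
suff /EK/(_ i Ki) : (x - y) *m E = 0 by rewrite !mxE.
set z := x - y.
(* Extension by zero outside [N] turns the moments over [N] into moments over all points. *)
pose c j := if j \in N then (z *m G) 0 j else 0.
have sumc e : \sum_j c j * a j ^+ e = \sum_(j in N) (z *m G) 0 j * a j ^+ e.
  rewrite [RHS]big_mkcond; apply: eq_bigr => j _; rewrite /c.
  by case: ifP; rewrite ?mul0r.
have c0 : forall j, c j = 0.
  apply: (@sparse_moments_eq0 _ _ a c (N :\: S) r) => //.
  - by rewrite cardsD (setIidPr subS) leq_subLR.
  - move=> j; rewrite inE negb_and negbK /c => /orP[Sj|]; last by case: (j \in N).
    by have := eqS j Sj; rewrite mulmxBl !mxE => ->; rewrite subrr if_same.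
  move=> e lt_e; have lt_em := leq_trans lt_e lerm.
  by rewrite sumc (momE z (Ordinal lt_em)) E0.
apply/rowP => e; rewrite -momE -sumc mxE big1 // => j _.
by rewrite c0 mul0r.
Qed.

Section Construction.

Variables (F : finFieldType) (k n1 n2 : nat) (a : 'I_(n1 + n2) -> F).
Hypothesis inj_a : injective a.
Variables (E1 : 'M[F]_(k, n1)) (E2 : 'M[F]_(k, n2)).

(** The inverse Vandermonde matrix of each block turns prescribed moments into the word having them:
    [E1] and [E2] send the data to the moments of the two blocks. *)
Definition moment_code_mx : 'M[F]_(k, n1 + n2) :=
  row_mx (E1 *m invmx (\matrix_(j, i) a (lshift n2 j) ^+ i))
         (E2 *m invmx (\matrix_(j, i) a (rshift n1 j) ^+ i)).

Lemma moment_code_depends1 (K : {set 'I_k}) :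
  (forall x y : 'rV[F]_k, {in K, forall i, x 0 i = y 0 i} ->
     x *m E1 = y *m E1) ->
  coded_depends_on moment_code_mx K (coded1 n1 n2).
Proof.
move=> depE x y /depE eqE j; rewrite inE !mul_mx_row => lt_j.
have -> : j = lshift n2 (Ordinal lt_j) by apply: val_inj.
by rewrite !row_mxEl !mulmxA eqE.
Qed.

Lemma moment_code_depends2 (K : {set 'I_k}) :
  (forall x y : 'rV[F]_k, {in K, forall i, x 0 i = y 0 i} ->
     x *m E2 = y *m E2) ->
  coded_depends_on moment_code_mx K (coded2 n1 n2).
Proof.
move=> depE x y /depE eqE j; rewrite inE !mul_mx_row.
case: (split_ordP j) => i -> /=; first by rewrite leqNgt ltn_ord.
by rewrite !row_mxEr !mulmxA eqE.
Qed.

Lemma moment_code_moment1 (x : 'rV[F]_k) (i : 'I_n1) :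
  \sum_(j in coded1 n1 n2) (x *m moment_code_mx) 0 j * a j ^+ i = (x *m E1) 0 i.
Proof.
rewrite big_mkcond big_split_ord /= [X in _ + X]big1 ?addr0; last first.
  by move=> j _; rewrite inE /= ltnNge leq_addr.
set W := \matrix_(j < n1, i < n1) a (lshift n2 j) ^+ i.
have uW : W \in unitmx by apply: moments_unit => j j' /inj_a /lshift_inj.
rewrite -[x *m E1](mulmxKV uW) [RHS]mxE; apply: eq_bigr => j _.
by rewrite inE /= ltn_ord mul_mx_row row_mxEl mulmxA [W _ _]mxE.
Qed.

Lemma moment_code_moment2 (x : 'rV[F]_k) (i : 'I_n2) :
  \sum_(j in coded2 n1 n2) (x *m moment_code_mx) 0 j * a j ^+ i = (x *m E2) 0 i.
Proof.
rewrite big_mkcond big_split_ord /= [X in X + _]big1 ?add0r; last first.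
  by move=> j _; rewrite inE /= leqNgt ltn_ord.
set W := \matrix_(j < n2, i < n2) a (rshift n1 j) ^+ i.
have uW : W \in unitmx by apply: moments_unit => j j' /inj_a /rshift_inj.
rewrite -[x *m E2](mulmxKV uW) [RHS]mxE; apply: eq_bigr => j _.
by rewrite inE /= leq_addr mul_mx_row row_mxEr mulmxA [W _ _]mxE.
Qed.

(** All [n1 + n2] points are distinct, so the sparse-word lemma applies to the concatenated word:
    its first [d] moments are sums of the two block moments, which cancel, and weight at most [d]
    forces it to be zero. *)
Lemma moment_code_min_distance_ge (d : nat) :
  (d < n1 + n2)%N -> (d <= n1)%N -> (d <= n2)%N ->
  (forall (x : 'rV[F]_k) (i1 : 'I_n1) (i2 : 'I_n2),
     i1 = i2 :> nat -> (i1 < d)%N -> (x *m E1) 0 i1 + (x *m E2) 0 i2 = 0) ->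
  (d < min_distance (code moment_code_mx))%N.
Proof.
move=> ltd le1 le2 E0; apply: min_distance_ge => // x; apply: contraR.
rewrite -leqNgt => wt; apply/eqP/rowP => j; rewrite [RHS]mxE.
move: j; apply: (sparse_moments_eq0 inj_a wt).
  by move=> j; rewrite inE negbK => /eqP.
move=> i lti; have lt1 := leq_trans lti le1; have lt2 := leq_trans lti le2.
rewrite -[RHS](E0 x (Ordinal lt1) (Ordinal lt2)) // -moment_code_moment1.
rewrite -moment_code_moment2 (bigID [in coded1 n1 n2]) /=; congr (_ + _).
by apply: eq_bigl => j; rewrite !inE -leqNgt.
Qed.

End Construction.

(* Choice of the moments and proof of optimality *)
Local Close Scope ring_scope.

Theorem theorem4 (q : nat) (F : finFieldType) (n1 k1 n2 k2 t r : nat)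
    (cardF : #|F| = q)
    (k1_gt0 : 1 <= k1) (k1_le_n1 : k1 <= n1)
    (k2_gt0 : 1 <= k2) (k2_le_n2 : k2 <= n2)
    (t_le : t <= minn k1 k2)
    (t_lt : t < k1 + k2 - t)
    (r1 : n1 - k1 = r) (r2 : n2 - k2 = r)
    (n_le : n1 + n2 <= q - 1) :
  exists G : 'M[F]_(k1 + k2 - t, n1 + n2),
    optimal_LEDC n1 k1 n2 k2 t G /\ min_distance (code G) = r + t + 1.
Proof.
have [let1 let2] : t <= k1 /\ t <= k2 by lia.
have n1E : n1 = k1 + r by lia.
have n2E : n2 = k2 + r by lia.
pose k := k1 + k2 - t.
(* The first [n1 + n2] elements in an enumeration of [F] serve as points; they are distinct because
   [n1 + n2 < q]. *)
pose a (j : 'I_(n1 + n2)) : F := nth 0%R (enum F) j.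
have inj_a : injective a.
  have lt_enum (j : 'I_(n1 + n2)) : j < size (enum F).
    by rewrite -cardE cardF; have := ltn_ord j; lia.
  by move=> i j /eqP; rewrite nth_uniq ?enum_uniq // => /eqP/val_inj.
(* Moments below [r] are zero. From [r] on, [f2] runs through the second data set in order, shared
   symbols first; [f1] also starts with the shared symbols, at index [k1 - t], and then takes the
   private ones from index 0. The sign in [s2] makes the shared moments of the two blocks
   opposite. *)
pose s1 (j : nat) : F := if j < r then 0%R else 1%R.
pose s2 (j : nat) : F := if j < r then 0%R else if j < r + t then (-1)%R else 1%R.
pose f1 j := if j < r + t then k1 - t + (j - r) else j - (r + t).
pose f2 j := k1 - t + (j - r).
pose E1 := placement_mx k n1 s1 f1; pose E2 := placement_mx k n2 s2 f2.
have E1lt (x : 'rV[F]_k) (i : 'I_n1) : i < r -> (x *m E1)%R 0%R i = 0%R.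
  by move=> lti; apply: mul_placement_mx0; rewrite /s1 lti.
have E2lt (x : 'rV[F]_k) (i : 'I_n2) : i < r -> (x *m E2)%R 0%R i = 0%R.
  by move=> lti; apply: mul_placement_mx0; rewrite /s2 lti.
have lt_f1 (j : 'I_n1) : r <= j -> f1 j < k1.
  by have := ltn_ord j; rewrite /f1; case: ifP; lia.
have lt_f2 (j : 'I_n2) : r <= j -> f2 j < k.
  by have := ltn_ord j; rewrite /f2 /k; lia.
have lt_k1 : k1 <= k by rewrite /k; lia.
have E1K (x : 'rV[F]_k) (i : 'I_k) :
    (x *m E1 = 0)%R -> i < k1 -> x 0%R i = 0%R.
  move=> xE lti.
  have [j lej fj] : exists2 j : 'I_n1, r <= j & f1 j = i.
    (* A private symbol [i] is the moment of order [i + (r + t)], a shared one the moment of order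
       [i - (k1 - t) + r]. *)
    have [hi | hi] := ltnP i (k1 - t).
      have ltj : i + (r + t) < n1 by lia.
      by exists (Ordinal ltj); rewrite /f1 /= ?ifF; lia.
    have ltj : i - (k1 - t) + r < n1 by lia.
    by exists (Ordinal ltj); rewrite /f1 /= ?ifT; lia.
  have := mul_placement_mx s1 x fj.
  by rewrite -/E1 xE mxE /s1 ltnNge lej mul1r.
have E2K (x : 'rV[F]_k) (i : 'I_k) :
    (x *m E2 = 0)%R -> k1 - t <= i -> x 0%R i = 0%R.
  move=> xE lei.
  have ltj : i - (k1 - t) + r < n2 by have := ltn_ord i; rewrite /k; lia.
  have fj : f2 (Ordinal ltj) = i by rewrite /f2 /=; lia.
  have := mul_placement_mx s2 x fj; rewrite -/E2 xE mxE /s2 /= ltnNge leq_addl.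
  by case: ifP => _ /esym/eqP; rewrite ?mulN1r ?mul1r ?oppr_eq0 => /eqP.
have ledc : is_LEDC n1 k1 n2 k2 t (moment_code_mx a E1 E2).
  split.
  - apply: moment_code_depends1 => x y eqxy; apply/rowP => j.
    have [ltj | /lt_f1 lt_j] := ltnP j r; first by rewrite !E1lt.
    have fj : f1 j = Ordinal (leq_trans lt_j lt_k1) by [].
    by rewrite /E1 !(mul_placement_mx _ _ fj) eqxy ?inE.
  - apply: moment_code_depends2 => x y eqxy; apply/rowP => j.
    have [ltj | /lt_f2 lt_j] := ltnP j r; first by rewrite !E2lt.
    have fj : f2 j = Ordinal lt_j by [].
    by rewrite /E2 !(mul_placement_mx _ _ fj) eqxy ?inE //= leq_addr.
  - move=> S subS cS.
    apply: (moments_determine inj_a (moment_code_moment1 inj_a E1 E2)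
      _ E1lt _ subS).
    + lia.
    + by move=> x xE i; rewrite inE; apply: E1K.
    + by rewrite card_coded1 cS n1E.
  - move=> S subS cS.
    apply: (moments_determine inj_a (moment_code_moment2 inj_a E1 E2)
      _ E2lt _ subS).
    + lia.
    + by move=> x xE i; rewrite inE; apply: E2K.
    + by rewrite card_coded2 cS n2E.
exists (moment_code_mx a E1 E2).
have dE : min_distance (code (moment_code_mx a E1 E2)) = r + t + 1.
  apply/eqP; rewrite eqn_leq (LEDC_min_distance_le n1E n2E) //= addn1.
  (* Applied with [d = r + t]: below [r] both moments are zero, and from [r] to [r + t - 1] they are
     a shared symbol and its opposite. *)
  apply: moment_code_min_distance_ge => //; try lia.
  move=> x i1 i2 eqi lti.
  have [ltr | ler] := ltnP i1 r; first by rewrite E1lt // E2lt -?eqi // addr0.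
  have lt_j := leq_trans (lt_f1 _ ler) lt_k1.
  have fj1 : f1 i1 = Ordinal lt_j by [].
  have fj2 : f2 i2 = Ordinal lt_j by rewrite /= /f1 /f2 lti eqi.
  rewrite /E1 /E2 (mul_placement_mx _ _ fj1) (mul_placement_mx _ _ fj2) /s1 /s2 -eqi.
  by rewrite lti ltnNge ler /= mul1r mulN1r subrr.
split=> //; split=> // F' G' ledc'.
(* The upper bound holds over every finite field, which gives optimality. *)
by rewrite dE (LEDC_min_distance_le n1E n2E).
Qed.
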